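(* Let $t>0$ and $n\ge 2$, and let $f(x)=h_n(x;t)=\sum_{d=1}^{n-1}\sum_{i=1}^{d}\binom{n-i-1}{d-i}\binom{n-d-1}{i-1}t^ix^d$. Then for all real $x$, $$f'(x)^2-f(x)f''(x)\ge 0,$$ where derivatives are with respect to $x$.
   Context: Binomial coefficients $\binom{m}{k}$ are $0$ when $k>m$ or $k<0$. $h_n(x;t)$ is the generating function $\sum_{d=1}^{n-1}g_{U_{n,d}}(t)x^d$ of Speyer's $g$-polynomials of the uniform matroids $U_{n,d}$. *)

(* Defs.v *)
From mathcomp Require Import all_boot all_order all_algebra.
From mathcomp Require Import all_classical all_reals all_analysis.

Set Implicit Arguments.
Unset Strict Implicit.
Unset Printing Implicit Defensive.

Import Order.TTheory GRing.Theory Num.Theory.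
Import numFieldNormedType.Exports.
Local Open Scope ring_scope.

(* Speyer's g-polynomial of the uniform matroid of rank d on n elements, given
   by its closed formula.  For 1 <= i <= d <= n - 1 none of the truncated
   subtractions below is negative in the integers. *)
Definition g_uniform (R : realType) (n d : nat) (t : R) : R :=
  \sum_(1 <= i < d.+1)
    ('C(n - i - 1, d - i) * 'C(n - d - 1, i - 1))%:R * t ^+ i.

Definition h (R : realType) (n : nat) (t x : R) : R :=
  \sum_(1 <= d < n) g_uniform n d t * x ^+ d.

(* Main.v *)
Require Import Defs.
From mathcomp Require Import all_boot all_order all_algebra.
From mathcomp Require Import all_classical all_reals all_analysis.
From mathcomp Require Import zify ring lra.

Set Implicit Arguments.
Unset Strict Implicit.
Unset Printing Implicit Defensive.

Import Order.TTheory GRing.Theory Num.Theory.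
Import numFieldNormedType.Exports.
Local Open Scope ring_scope.

(** Trinomial revision turns the double sum into
      h_(m+2)(x;t) = t x S_m(1 + x, t x),
      S_m(a,b) = sum_j C(m-j,j) a^(m-2j) b^j.
    Since S_m(2 cos u, -1) = sin((m+1)u) / sin u is the Chebyshev polynomial of
    the second kind, S_m(a,b) = a^(m mod 2) prod_k (a^2 + 4 b cos^2 u_k) with
    u_k = k pi / (m+1) and 1 <= k <= m/2.  At a = 1 + x, b = t x every factor
    is real-rooted in x, and f'^2 - f f'' >= 0 is inherited by products because
    L(f) = f'^2 - f f'' satisfies L(pq) = q^2 L(p) + p^2 L(q). *)

Definition laguerre (R : realType) (p : {poly R}) :=
  forall x, 0 <= p^`().[x] ^+ 2 - p.[x] * p^`()^`().[x].

Lemma laguerreM (R : realType) (p q : {poly R}) :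
  laguerre p -> laguerre q -> laguerre (p * q).
Proof.
move=> Lp Lq x.
have -> : (p * q)^`().[x] ^+ 2 - (p * q).[x] * (p * q)^`()^`().[x] =
    q.[x] ^+ 2 * (p^`().[x] ^+ 2 - p.[x] * p^`()^`().[x]) +
    p.[x] ^+ 2 * (q^`().[x] ^+ 2 - q.[x] * q^`()^`().[x]).
  by rewrite derivM derivD !derivM !hornerE /=; ring.
by rewrite addr_ge0 // mulr_ge0 // sqr_ge0.
Qed.

Lemma laguerre_linear (R : realType) (a b : R) : laguerre (a *: 'X + b%:P).
Proof.
move=> x.
have -> : (a *: 'X + b%:P)^`() = a%:P.
  by rewrite derivD derivC derivZ derivX addr0 alg_polyC.
by rewrite derivC horner0 mulr0 subr0 sqr_ge0.
Qed.

Lemma laguerre1 (R : realType) : laguerre (1 : {poly R}).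
Proof. by have := laguerre_linear (0 : R) 1; rewrite scale0r add0r. Qed.

Lemma laguerre_prod (R : realType) (I : Type) (r : seq I) (F : I -> {poly R}) :
  (forall i, laguerre (F i)) -> laguerre (\prod_(i <- r) F i).
Proof.
by move=> LF; apply: big_ind => //; [exact: laguerre1|exact: laguerreM].
Qed.

Lemma laguerre_quadratic (R : realType) (c : R) :
  0 <= c -> laguerre ((1 + 'X) ^+ 2 + c *: 'X).
Proof.
move=> c0 x.
have -> : ((1 + 'X) ^+ 2 + c *: 'X)^`() = 2%:P * (1 + 'X) + c%:P.
  rewrite derivD deriv_exp derivD derivZ derivX -polyC1 derivC alg_polyC.
  by rewrite polyC_natr polyC1 /=; ring.
have -> : (2%:P * (1 + 'X) + c%:P)^`() = 2%:P :> {poly R}.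
  by rewrite derivD derivM derivD -polyC1 !derivC derivX polyC1 polyC_natr; ring.
rewrite !hornerE /=.
(* A sum-of-squares certificate; [c >= 0] enters only through the term [2 * c]. *)
have -> : (2 * (1 + x) + c) ^+ 2 - ((1 + x) ^+ 2 + c * x) * 2 =
    (1 + x) ^+ 2 + (1 + x + c) ^+ 2 + 2 * c by ring.
by rewrite !addr_ge0 ?sqr_ge0 // mulr_ge0.
Qed.

(** This is S_m. For 2j > m the exponent truncates to 0, but the binomial vanishes. *)
Definition fib_sum (R : realType) (m : nat) (a b : R) : R :=
  \sum_(j < m.+1) 'C(m - j, j)%:R * a ^+ (m - j.*2) * b ^+ j.

Lemma fib_sumE (R : realType) m (a b : R) :
  fib_sum m a b =
  \sum_(j < m./2.+1) 'C(m - j, j)%:R * a ^+ (m - j.*2) * b ^+ j.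
Proof.
have le : (m./2.+1 <= m.+1)%N by lia.
rewrite /fib_sum (big_ord_widen _
  (fun j => 'C(m - j, j)%:R * a ^+ (m - j.*2) * b ^+ j) le).
rewrite [RHS]big_mkcond /=; apply: eq_bigr => j _.
case: ifP => // h; rewrite bin_small ?mul0r //; lia.
Qed.

(** Pascal's rule on C(m+1-j, j+1), after splitting off the j = 0 terms. *)
Lemma fib_sum_rec (R : realType) m (a b : R) :
  fib_sum m.+2 a b = a * fib_sum m.+1 a b + b * fib_sum m a b.
Proof.
rewrite /fib_sum big_ord_recl [in X in a * X]big_ord_recl /= big_ord_recr /=.
rewrite [X in _ + (_ + X)](_ : _ = 0); last first.
  by rewrite bin_small ?mul0r // /bump; lia.
rewrite addr0 mulrDr -addrA; congr (_ + _).
  by rewrite !subn0 !bin0 !mul1r !mulr1 exprS.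
rewrite !mulr_sumr -big_split /=; apply: eq_bigr => -[j /= jm] _.
rewrite /bump /= !add1n subSS subSn ?binS ?natrD; last by lia.
rewrite subSS.
have -> : (m.+2 - j.+1.*2 = m - j.*2)%N by lia.
have [h|h] := leqP j.*2.+1 m.
  have -> : (m - j.*2 = (m.+1 - j.+1.*2).+1)%N by lia.
  by rewrite !exprS; ring.
(* Here the exponent of [a] truncates, so the powers do not match, but C(m-j, j+1) = 0. *)
by rewrite (@bin_small (m - j) j.+1) ?exprS; [ring|lia].
Qed.

(** Both sides satisfy s_(m+2) = 2 cos u s_(m+1) - s_m, hence the induction on two consecutive
    indices. *)
Lemma fib_sum_sin (R : realType) m (u : R) :
  fib_sum m (2 * cos u) (-1) * sin u = sin (u *+ m.+1).
Proof.
suff: fib_sum m (2 * cos u) (-1) * sin u = sin (u *+ m.+1) /\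
      fib_sum m.+1 (2 * cos u) (-1) * sin u = sin (u *+ m.+2) by case.
elim: m => [|m [IH1 IH2]].
  rewrite /fib_sum !big_ord_recl !big_ord0 /= /bump /= sin_mulr2n.
  by rewrite !bin0 subn0 bin_small // ?expr0 ?expr1 mulr2n; split; ring.
split=> //; rewrite fib_sum_rec mulrDl -!mulrA IH1 IH2.
have -> : u *+ m.+1 = u *+ m.+2 - u by rewrite (mulrSr u m.+1) addrK.
by rewrite (mulrSr u m.+2) (sinD _ u) (sinB _ u); ring.
Qed.

(* Dehomogenization: S_m(a,b) = a^(m mod 2) b^(m/2) fib_poly(a^2 / b).  It is
   monic, which is why the variable is a^2 / b and not b / a^2. *)
Definition fib_poly (R : realType) (m : nat) : {poly R} :=
  \poly_(i < m./2.+1) 'C(m - (m./2 - i), m./2 - i)%:R.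

Lemma fib_sum_poly (R : realType) m (a b : R) : b != 0 ->
  fib_sum m a b = a ^+ odd m * b ^+ m./2 * (fib_poly R m).[a ^+ 2 / b].
Proof.
move=> b0; rewrite fib_sumE horner_poly mulr_sumr.
rewrite (reindex_inj rev_ord_inj) /=; apply: eq_bigr => -[i /= im] _.
rewrite subSS expr_div_n -exprM.
have -> : (m - (m./2 - i).*2 = odd m + 2 * i)%N by have := odd_double_half m; lia.
have -> : b ^+ m./2 = b ^+ (m./2 - i) * b ^+ i by rewrite -exprD subnK.
by rewrite exprD; field; rewrite expf_neq0.
Qed.

(* [k] is shifted by one: these are the angles u_(k+1). *)
Definition fib_angle (R : realType) (m k : nat) : R := pi * k.+1%:R / m.+1%:R.

Lemma fib_angle_itv (R : realType) m k : (k < m./2)%N ->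
  0 < fib_angle R m k < pi / 2.
Proof.
move=> km; rewrite /fib_angle; have pi0 := pi_gt0 R.
rewrite divr_gt0 ?mulr_gt0 ?ltr0n //= -mulrA ltr_pM2l //.
rewrite ltr_pdivrMr ?ltr0n // mulrC ltr_pdivlMr ?ltr0n // -natrM ltr_nat; lia.
Qed.

(** At a = 2 cos u, b = -1 the variable a^2 / b is -4 cos^2 u, and sin((m+1)u) = sin((k+1) pi) = 0.
    As sin u and cos u are positive, only the factor [fib_poly] can vanish. *)
Lemma fib_poly_root (R : realType) m k : (k < m./2)%N ->
  root (fib_poly R m) (- (4 * cos (fib_angle R m k) ^+ 2)).
Proof.
move=> km; have := fib_angle_itv R km; set u := fib_angle R m k => /andP[u0 u2].
have pi0 := pi_gt0 R.
have cu : 0 < cos u by apply: cos_gt0_pihalf; lra.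
have su : 0 < sin u by apply: sin_gt0_pi; lra.
have : fib_sum m (2 * cos u) (-1) * sin u = 0.
  rewrite fib_sum_sin -mulr_natr /u /fib_angle divfK ?pnatr_eq0 //.
  rewrite mulr_natr; elim: k.+1 => [|j IH]; first by rewrite mulr0n sin0.
  by rewrite mulrSr sinDpi IH oppr0.
move/eqP; rewrite mulf_eq0 (gt_eqF su) orbF fib_sum_poly ?oppr_eq0 ?oner_eq0 //.
rewrite !mulf_eq0 !expf_eq0 oppr_eq0 oner_eq0 andbF orbF.
rewrite mulf_eq0 pnatr_eq0 (gt_eqF cu) andbF /= /root.
by rewrite invrN1 mulrN1 exprMn -natrX.
Qed.

(** A monic polynomial of degree m/2 with m/2 known roots. They are distinct because cos is positive
    and injective on (0, pi/2). *)
Lemma fib_poly_factor (R : realType) m :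
  fib_poly R m =
  \prod_(k < m./2) ('X + (4 * cos (fib_angle R m k) ^+ 2)%:P).
Proof.
pose r k : R := - (4 * cos (fib_angle R m k) ^+ 2).
have l1 : 'C(m - (m./2 - m./2), m./2 - m./2)%:R != 0 :> R.
  by rewrite subnn bin0 oner_eq0.
have -> := @all_roots_prod_XsubC _ (fib_poly R m) (map r (iota 0 m./2)).
- rewrite /fib_poly lead_coef_poly // subnn bin0 scale1r big_map.
  rewrite -{1}[m./2]subn0 -/(index_iota 0 m./2) big_mkord.
  by apply: eq_bigr => k _; rewrite /r polyCN opprK.
- by rewrite size_map size_iota size_poly_eq.
- apply/allP => _ /mapP[k + ->]; rewrite mem_iota add0n => /andP[_ km].
  exact: fib_poly_root.
rewrite uniq_rootsE map_inj_in_uniq ?iota_uniq // => i j.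
rewrite !mem_iota !add0n => /andP[_ im] /andP[_ jm].
have /andP[ui vi] := fib_angle_itv R im; have /andP[uj vj] := fib_angle_itv R jm.
have pi0 := pi_gt0 R.
rewrite /r => /oppr_inj /(mulfI _) h.
have {}h : cos (fib_angle R m i) = cos (fib_angle R m j).
  apply: (@pexpIrn _ 2) => //; rewrite ?nnegrE; last by apply: h; rewrite pnatr_eq0.
  - by apply/ltW/cos_gt0_pihalf; lra.
  - by apply/ltW/cos_gt0_pihalf; lra.
have : fib_angle R m i = fib_angle R m j.
  by apply: cos_inj h; rewrite in_itv /=; lra.
rewrite /fib_angle => /(mulIf _) e; have {e} := e _.
rewrite invr_eq0 pnatr_eq0 => /(_ isT) /(mulfI (lt0r_neq0 pi0)) /eqP.
by rewrite eqr_nat => /eqP [].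
Qed.

(** One [b] from b^(m/2) clears the denominator of each linear factor. *)
Lemma fib_sum_factor (R : realType) m (a b : R) : b != 0 ->
  fib_sum m a b = a ^+ odd m *
    \prod_(k < m./2) (a ^+ 2 + 4 * cos (fib_angle R m k) ^+ 2 * b).
Proof.
move=> b0; rewrite fib_sum_poly // fib_poly_factor horner_prod -mulrA.
congr (_ * _); rewrite -{1}(card_ord m./2) -prodr_const -big_split /=.
by apply: eq_bigr => k _; rewrite !hornerE; field.
Qed.

(** Both sides equal (m-j)! / ((e-j)! j! (m-e-j)!) when j <= m - e, and 0 otherwise. *)
Lemma bin_mul_swap m j e : (j <= e <= m)%N ->
  ('C(m - j, e - j) * 'C(m - e, j) = 'C(m - j, j) * 'C(m - j.*2, e - j))%N.
Proof.
move=> /andP[je em]; have [h|h] := leqP j (m - e); last first.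
  rewrite (bin_small h) muln0; have [h2|h2] := leqP j.*2 m.
    by rewrite (@bin_small (m - j.*2)) ?muln0 //; lia.
  by rewrite (@bin_small (m - j)) ?mul0n //; lia.
apply/eqP; rewrite -(eqn_pmul2r (_ : 0 < (e - j)`! * (m - e)`! * j`! * (m - e - j)`!))%N;
  last by rewrite !muln_gt0 !fact_gt0.
have e1 := @bin_fact (m - j) (e - j) ltac:(lia).
have e2 := @bin_fact (m - e) j h.
have e3 := @bin_fact (m - j) j ltac:(lia).
have e4 := @bin_fact (m - j.*2) (e - j) ltac:(lia).
rewrite (_ : m - j - (e - j) = m - e)%N in e1; last by lia.
rewrite (_ : m - j - j = m - j.*2)%N in e3; last by lia.
rewrite (_ : m - j.*2 - (e - j) = m - e - j)%N in e4; last by lia.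
apply/eqP; transitivity ((m - j)`! * (m - e)`!)%N.
  by rewrite -{1}e1 -e2; ring.
by rewrite -e3 -e4; ring.
Qed.

(** Put d = e+1, i = j+1 and sum over e first: after [bin_mul_swap] the inner sum is x^j times the
    expansion of (1+x)^(m-2j). *)
Lemma h_fib_sum (R : realType) m (t x : R) :
  h m.+2 t x = t * x * fib_sum m (1 + x) (t * x).
Proof.
rewrite /h /g_uniform big_add1 /= big_mkord mulr_sumr.
transitivity (\sum_(e < m.+1) \sum_(j < m.+1 | (j <= e)%N)
   ('C(m - j, j) * 'C(m - j.*2, e - j))%:R * t ^+ j.+1 * x ^+ e.+1).
  apply: eq_bigr => -[e /= em] _; rewrite big_add1 /= big_mkord mulr_suml.
  rewrite (big_ord_widen _ (fun j => ('C(m.+2 - j.+1 - 1, e.+1 - j.+1) *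
    'C(m.+2 - e.+1 - 1, j.+1 - 1))%:R * t ^+ j.+1 * x ^+ e.+1) em).
  apply: eq_bigr => -[j /= jm]; rewrite ltnS => je.
  rewrite -bin_mul_swap; last by lia.
  by rewrite !subSS !subn1 !subn0 /= -!subnS !subSS.
rewrite (exchange_big_dep xpredT) //=; apply: eq_bigr => -[j /= jm] _.
have [h2|h2] := leqP j.*2 m; last first.
  have -> : 'C(m - j, j) = 0%N by rewrite bin_small //; lia.
  by rewrite big1 => [|e _]; rewrite ?mul0n mulr0n !mul0r ?mulr0.
under eq_bigl do rewrite -[(_ <= _)%N]andTb.
rewrite -(big_geq_mkord (0 + j) m.+1 xpredT (fun e =>
  ('C(m - j, j) * 'C(m - j.*2, e - j))%:R * t ^+ j.+1 * x ^+ e.+1)).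
rewrite big_addn big_mkord exprDn mulr_sumr mulr_suml mulr_sumr.
(* The left side has extra indices i > m - 2j, where C(m-2j, i) = 0. *)
have le : ((m - j.*2).+1 <= m.+1 - j)%N by lia.
rewrite [RHS](big_ord_widen _ (fun i => t * x * ('C(m - j, j)%:R *
  (1 ^+ (m - j.*2 - i) * x ^+ i *+ 'C(m - j.*2, i)) * (t * x) ^+ j)) le).
rewrite [RHS]big_mkcond /=; apply: eq_bigr => -[i /= im] _; rewrite addnK.
case: ifP => hi; last by rewrite (@bin_small _ i) ?muln0 ?mul0r //; lia.
by rewrite expr1n natrM exprMn -addSn exprD !exprS -mulr_natr; ring.
Qed.

Theorem theorem8p1 (R : realType) (n : nat) (t : R)
  (ht : 0 < t) (hn : (2 <= n)%N) (x : R) :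
  0 <= derive1 (h n t) x ^+ 2 - h n t x * derive1n 2 (h n t) x.
Proof.
case: n hn => [|[|m]] // _.
pose P : {poly R} := (t *: 'X + 0%:P) * ((1 *: 'X + 1%:P) ^+ odd m *
  \prod_(k < m./2) ((1 + 'X) ^+ 2 + (4 * cos (fib_angle R m k) ^+ 2 * t) *: 'X)).
have hP : h m.+2 t = horner P.
  apply/funext => y; rewrite h_fib_sum /P !hornerE /= horner_prod -!mulrA.
  (* The factorization divides by b = t y; at y = 0 the prefactor t y kills both sides. *)
  have [->|y0] := eqVneq y 0; first by rewrite !mul0r.
  have ty0 : t * y != 0 by rewrite mulf_neq0 // gt_eqF.
  rewrite fib_sum_factor // (addrC y).
  congr (_ * (_ * (_ * _))); apply: eq_bigr => k _.
  by rewrite !hornerE /=; ring.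
rewrite hP derive1Sn derive1n1 -!derivE.
apply: laguerreM; first exact: laguerre_linear.
apply: laguerreM; last first.
  apply: laguerre_prod => k; apply: laguerre_quadratic.
  by rewrite mulr_ge0 ?(ltW ht) // mulr_ge0 // sqr_ge0.
by case: odd; [exact: laguerre_linear|exact: laguerre1].
Qed.
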